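(* Let $R$ be a commutative noetherian domain and let $B=R_{\mathbf p}(\mathbf t,\boldsymbol\sigma,\mathbf H,\mathbf J)$ be a BR algebra of rank $n$. Let $\Gamma$ be the subgroup of $\operatorname{Aut}(R)$ generated by $\sigma_1,\dots,\sigma_n$ and let $$\mathcal X=\left(\{a\mathbf t^{\boldsymbol\alpha}\mid a\in I^{(\boldsymbol\alpha)},\ \boldsymbol\alpha>0\}\cup\{1\}\right)\setminus\{0\}.$$ Then $B$ is simple if and only if the following conditions hold: (1) $BxB=B$ for all $x\in\mathcal X$; (2) $R$ is $\Gamma$-simple; and (3) $\mathcal Z(B)\subset R$.
   Context: All algebras are associative unital algebras over a field $\Bbbk$; $\mathcal Z(B)$ is the center of $B$. A matrix $\mathbf p=(p_{ik})\in M_n(\Bbbk^\times)$ is multiplicatively antisymmetric if $p_{ik}=p_{ki}^{-1}$. For $\boldsymbol\alpha\in\mathbb Z^n$, $\boldsymbol\alpha>0$ means $\alpha_i\ge0$ for all $i$ and $\boldsymbol\alpha\ne\mathbf0$. $R$ is $\Gamma$-simple if for every ideal $I$ of $R$, $\sigma(I)=I$ for all $\sigma\in\Gamma$ implies $I=0$ or $I=R$. BR algebra: given commuting automorphisms $\boldsymbol\sigma=(\sigma_1,\dots,\sigma_n)$ of $R$ and multiplicatively antisymmetric $\mathbf p$, let $R_{\mathbf p}[\mathbf t^{\pm1};\boldsymbol\sigma]$ be generated over $R$ by $t_1^{\pm1},\dots,t_n^{\pm1}$ with $t_i^{\pm1}r=\sigma_i^{\pm1}(r)t_i^{\pm1}$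 and $t_kt_i=p_{ik}t_it_k$ for $i\ne k$. Let $\mathbf H=(H_1,\dots,H_n)$, $\mathbf J=(J_1,\dots,J_n)$ be ideals of $R$. Put $I_i^{(k)}=J_i\sigma_i(J_i)\cdots\sigma_i^{k-1}(J_i)$ for $k>0$, $I_i^{(0)}=R$, $I_i^{(k)}=\sigma_i^{-1}(H_i)\cdots\sigma_i^{k}(H_i)$ for $k<0$. Assume that $\sigma_i(H_k)=H_k$, $\sigma_i(J_k)=J_k$, $H_iH_k=H_kH_i$, $H_iJ_k=J_kH_i$, $J_iJ_k=J_kJ_i$ for $i\ne k$, and $I_i^{(k)}\neq0$ for all $i,k$. Then $R_{\mathbf p}(\mathbf t,\boldsymbol\sigma,\mathbf H,\mathbf J)=\bigoplus_{\boldsymbol\alpha\in\mathbb Z^n}I^{(\boldsymbol\alpha)}\mathbf t^{\boldsymbol\alpha}\subset R_{\mathbf p}[\mathbf t^{\pm1};\boldsymbol\sigma]$, where $I^{(\boldsymbol\alpha)}=I_1^{(\alpha_1)}\cdots I_n^{(\alpha_n)}$ and $\mathbf t^{\boldsymbol\alpha}=t_1^{\alpha_1}\cdots t_n^{\alpha_n}$; $R$ is identified with the degree-$\mathbf0$ part. *)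

(* Defs.v *)
From HB Require Import structures.
From mathcomp Require Import all_boot all_order all_algebra.
From mathcomp Require Import finmap boolp classical_sets monalg.

Set Implicit Arguments.
Unset Strict Implicit.
Unset Printing Implicit Defensive.

Import Order.TTheory GRing.Theory Num.Theory.

Local Open Scope classical_set_scope.
Local Open Scope ring_scope.

(* A subring of an ambient ring [A] is represented by its carrier
   [S : set A]; [S = setT] gives the notions for [A] itself. *)

Section SubringNotions.
Variable A : pzRingType.
Implicit Types (S I J : set A) (x : A).

Definition ideal_of S I : Prop :=
  [/\ I `<=` S,
      I 0,
      forall x y, I x -> I y -> I (x - y) &
      forall s x, S s -> I x -> I (s * x) /\ I (x * s)].

Definition simple_ring S : Prop :=
  S <> [set 0] /\ forall I, ideal_of S I -> I = [set 0] \/ I = S.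

Definition center S : set A :=
  [set z | S z /\ forall s, S s -> z * s = s * z].

(* The finite sums of products [a * b] with [a] in [I] and [b] in [J]. *)
Definition idealM I J : set A :=
  [set x | exists2 s : seq (A * A),
     forall u, u \in s -> I u.1 /\ J u.2 & x = \sum_(u <- s) u.1 * u.2].

(* The two-sided ideal S x S. *)
Definition principal S x : set A :=
  [set y | exists2 s : seq (A * A),
     forall u, u \in s -> S u.1 /\ S u.2 & y = \sum_(u <- s) u.1 * x * u.2].

Definition noetherian : Prop :=
  forall I : nat -> set A,
    (forall m, ideal_of setT (I m)) -> (forall m, I m `<=` I m.+1) ->
    exists N, forall m, (N <= m)%N -> I m = I N.

End SubringNotions.

Section Groups.
Variable T : Type.

(* The subgroup generated by [X] in the group of self-bijections of [T]. *)
Inductive gen_subgroup (X : set (T -> T)) : set (T -> T) :=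
| gen_subgroup_in g : X g -> gen_subgroup X g
| gen_subgroup_id : gen_subgroup X id
| gen_subgroup_comp g h :
    gen_subgroup X g -> gen_subgroup X h -> gen_subgroup X (g \o h)
| gen_subgroup_inv g h :
    cancel g h -> cancel h g -> gen_subgroup X g -> gen_subgroup X h.

End Groups.

Definition gamma_simple (R : pzRingType) (Gamma : set (R -> R)) : Prop :=
  forall I : set R, ideal_of setT I ->
    (forall g, Gamma g -> g @` I = I) -> I = [set 0] \/ I = setT.

(* The data defining R_p[t^{+-1}; sigma]; the field [laurent_sigmaV] is the
   family of the inverse automorphisms. *)
Record laurentData (K : fieldType) (R : algType K) (n : nat) := LaurentData {
  laurent_p : 'M[K]_n;
  laurent_sigma : 'I_n -> {lrmorphism R -> R};
  laurent_sigmaV : 'I_n -> R -> R;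
  laurent_p_neq0 : forall i k, laurent_p i k != 0;
  laurent_p_antisym : forall i k, laurent_p i k = (laurent_p k i)^-1;
  laurent_sigmaK : forall i, cancel (laurent_sigma i) (laurent_sigmaV i);
  laurent_sigmaVK : forall i, cancel (laurent_sigmaV i) (laurent_sigma i);
  laurent_sigmaC : forall i k r,
    laurent_sigma i (laurent_sigma k r) = laurent_sigma k (laurent_sigma i r)
}.

Notation multideg n := {ffun 'I_n -> int}.

Definition unitdeg n (i : 'I_n) (m : int) : multideg n :=
  [ffun j => if j == i then m else 0].

Definition pos_deg n (a : multideg n) : Prop :=
  (forall i, 0 <= a i) /\ a != 0.

Section Action.
Variables (K : fieldType) (R : algType K) (n : nat) (D : laurentData R n).

Local Notation p := (laurent_p D).
Local Notation sg := (laurent_sigma D).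
Local Notation sgV := (laurent_sigmaV D).

(* [sigmaX i m] is sigma_i^m, and [sigma_deg a] is
   sigma_1^{a_1} ... sigma_n^{a_n}. *)
Definition sigmaX (i : 'I_n) (m : int) (r : R) : R :=
  match m with
  | Posz k => iter k (sg i) r
  | Negz k => iter k.+1 (sgV i) r
  end.

Definition sigma_deg (a : multideg n) (r : R) : R :=
  foldr (fun i => sigmaX i (a i)) r (enum 'I_n).

(* The scalar such that t^a t^b = cocycle a b t^{a+b}: each t_k^{a_k} with
   i < k has to be moved to the right past t_i^{b_i}. *)
Definition cocycle (a b : multideg n) : K :=
  \prod_(i < n) \prod_(k < n | (i < k)%N) p i k ^ (a k * b i).

Lemma sgVB i : {morph sgV i : x y / x - y}.
Proof.
by move=> x y; apply: (can_inj (laurent_sigmaK D i)); rewrite raddfB /= !laurent_sigmaVK.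
Qed.

Lemma sgVM i : {morph sgV i : x y / x * y}.
Proof.
by move=> x y; apply: (can_inj (laurent_sigmaK D i)); rewrite rmorphM /= !laurent_sigmaVK.
Qed.

Lemma sgV1 i : sgV i 1 = 1.
Proof. by rewrite -{1}(rmorph1 (sg i)) laurent_sigmaK. Qed.

Lemma sgVZ i c x : sgV i (c *: x) = c *: sgV i x.
Proof.
by apply: (can_inj (laurent_sigmaK D i)); rewrite linearZ /= !laurent_sigmaVK.
Qed.

Lemma sgVC i k r : sg i (sgV k r) = sgV k (sg i r).
Proof.
by apply: (can_inj (laurent_sigmaK D k)); rewrite (laurent_sigmaC D k i) !laurent_sigmaVK.
Qed.

Lemma sgVVC i k r : sgV i (sgV k r) = sgV k (sgV i r).
Proof.
by apply: (can_inj (laurent_sigmaK D i)); rewrite [RHS]sgVC !laurent_sigmaVK.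
Qed.

Lemma sigmaXB i m : {morph sigmaX i m : x y / x - y}.
Proof.
case: m => k x y; rewrite /sigmaX; [elim: k|elim: k.+1] => //= {}k ->.
  exact: raddfB.
exact: sgVB.
Qed.

Lemma sigmaXM i m : {morph sigmaX i m : x y / x * y}.
Proof.
case: m => k x y; rewrite /sigmaX; [elim: k|elim: k.+1] => //= {}k ->.
  exact: rmorphM.
exact: sgVM.
Qed.

Lemma sigmaX1 i m : sigmaX i m 1 = 1.
Proof.
case: m => k; rewrite /sigmaX; [elim: k|elim: k.+1] => //= {}k ->.
  exact: rmorph1.
exact: sgV1.
Qed.

Lemma sigmaXZ i m c x : sigmaX i m (c *: x) = c *: sigmaX i m x.
Proof.
case: m => k; rewrite /sigmaX; [elim: k|elim: k.+1] => //= {}k ->.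
  exact: linearZ.
exact: sgVZ.
Qed.

Lemma sg_sigmaXC i k m r : sg i (sigmaX k m r) = sigmaX k m (sg i r).
Proof.
case: m => l; rewrite /sigmaX; [elim: l|elim: l.+1] => //= {}l <-.
  exact: laurent_sigmaC.
exact: sgVC.
Qed.

Lemma sgV_sigmaXC i k m r : sgV i (sigmaX k m r) = sigmaX k m (sgV i r).
Proof.
by apply: (can_inj (laurent_sigmaK D i)); rewrite sg_sigmaXC !laurent_sigmaVK.
Qed.

Lemma sigmaXC i k m l r : sigmaX i m (sigmaX k l r) = sigmaX k l (sigmaX i m r).
Proof.
have h f j : (forall x, f (sigmaX k l x) = sigmaX k l (f x)) ->
    iter j f (sigmaX k l r) = sigmaX k l (iter j f r).
  by move=> fC; elim: j => //= j ->.
case: m => j; apply: h => x; first exact: sg_sigmaXC.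
exact: sgV_sigmaXC.
Qed.

Lemma sigmaXS i m r : sigmaX i (1 + m) r = sg i (sigmaX i m r).
Proof.
case: m => [k|[|k]]; first by rewrite -PoszD.
  by rewrite /= laurent_sigmaVK.
have -> : (1 + Negz k.+1 = Negz k)%R.
  by rewrite !NegzE -[k.+2]addn1 PoszD opprD addrCA subrr addr0.
by rewrite [in RHS]/sigmaX iterS laurent_sigmaVK.
Qed.

Lemma sigmaXP i m r : sigmaX i (m - 1) r = sgV i (sigmaX i m r).
Proof. by rewrite -{2}(subrK 1 m) [m - 1 + 1]addrC sigmaXS laurent_sigmaK. Qed.

Lemma sigmaXD i m l r : sigmaX i (m + l) r = sigmaX i m (sigmaX i l r).
Proof.
elim/int_rec: m => [|k IH|k IH]; first by rewrite add0r.
  by rewrite -addn1 PoszD [(k%:Z + 1)%R]addrC -addrA !sigmaXS IH.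
by rewrite -addn1 PoszD opprD addrAC !sigmaXP IH.
Qed.

Lemma sigma_degB a : {morph sigma_deg a : x y / x - y}.
Proof.
by move=> x y; rewrite /sigma_deg; elim: (enum _) => //= i s ->; rewrite sigmaXB.
Qed.

HB.instance Definition _ a :=
  GRing.isZmodMorphism.Build R R (sigma_deg a) (@sigma_degB a).

Lemma sigma_degM a : {morph sigma_deg a : x y / x * y}.
Proof.
by move=> x y; rewrite /sigma_deg; elim: (enum _) => //= i s ->; rewrite sigmaXM.
Qed.

Lemma sigma_deg1 a : sigma_deg a 1 = 1.
Proof. by rewrite /sigma_deg; elim: (enum _) => //= i s ->; rewrite sigmaX1. Qed.

Lemma sigma_degZ a c x : sigma_deg a (c *: x) = c *: sigma_deg a x.
Proof. by rewrite /sigma_deg; elim: (enum _) => //= i s ->; rewrite sigmaXZ. Qed.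

Lemma sigma_deg0 r : sigma_deg 0 r = r.
Proof. by rewrite /sigma_deg; elim: (enum _) => //= i s ->; rewrite ffunE. Qed.

Lemma sigma_degD a b r : sigma_deg (a + b) r = sigma_deg a (sigma_deg b r).
Proof.
rewrite /sigma_deg; elim: (enum _) => //= i s ->; rewrite ffunE sigmaXD.
congr (sigmaX i _ _); elim: s {r}(foldr _ r s) => //= j s IH r.
by rewrite -IH sigmaXC.
Qed.

Lemma sigma_deg_unit i m r : sigma_deg (unitdeg i m) r = sigmaX i m r.
Proof.
rewrite /sigma_deg.
have h s : uniq s ->
  foldr (fun j => sigmaX j (unitdeg i m j)) r s = if i \in s then sigmaX i m r else r.
  elim: s => //= j s IH /andP[js us]; rewrite IH // ffunE inE (eq_sym i).
  by case: eqVneq js => [->|_ _] //= /negbTE->.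
by rewrite h ?enum_uniq // mem_enum.
Qed.

Lemma cocycleDl a a' b : cocycle (a + a') b = cocycle a b * cocycle a' b.
Proof.
rewrite /cocycle -big_split /=; apply: eq_bigr => i _.
rewrite -big_split /=; apply: eq_bigr => k _.
by rewrite ffunE mulrDl expfzDr ?laurent_p_neq0.
Qed.

Lemma cocycleDr a b b' : cocycle a (b + b') = cocycle a b * cocycle a b'.
Proof.
rewrite /cocycle -big_split /=; apply: eq_bigr => i _.
rewrite -big_split /=; apply: eq_bigr => k _.
by rewrite ffunE mulrDr expfzDr ?laurent_p_neq0.
Qed.

Lemma cocycle0l b : cocycle 0 b = 1.
Proof. by apply: big1 => i _; apply: big1 => k _; rewrite ffunE mul0r expr0z. Qed.

Lemma cocycle0r a : cocycle a 0 = 1.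
Proof. by apply: big1 => i _; apply: big1 => k _; rewrite ffunE mulr0 expr0z. Qed.

Lemma cocycle_unit k i m l :
  cocycle (unitdeg k m) (unitdeg i l) = if (i < k)%N then p i k ^ (m * l) else 1.
Proof.
rewrite /cocycle (bigD1 i) //= [X in _ * X]big1 ?mulr1 => [|j ji]; last first.
  by apply: big1 => l' _; rewrite [unitdeg i l j]ffunE (negbTE ji) mulr0 expr0z.
case: ifP => ik; last first.
  apply: big1 => j ij; rewrite ffunE; case: eqVneq ij => [->|_ _]; first by rewrite ik.
  by rewrite mul0r expr0z.
rewrite (bigD1 k) //= big1 ?mulr1 ?ffunE ?eqxx //.
by move=> j /andP[_ jk]; rewrite ffunE (negbTE jk) mul0r expr0z.
Qed.

End Action.

(* The algebra R_p[t^{+-1}; sigma]: the free left R-module on the monomials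
   t^a, with (r t^a)(s t^b) = r sigma^a(s) t^a t^b. *)
Definition skew_laurent (K : fieldType) (R : algType K) (n : nat)
  (D : laurentData R n) : Type := {malg R[multideg n]}.

Section Laurent.
Variables (K : fieldType) (R : algType K) (n : nat) (D : laurentData R n).

Local Notation L := (skew_laurent D).
Local Notation sga := (sigma_deg D).
Local Notation coc := (cocycle D).

HB.instance Definition _ := GRing.Zmodule.on L.

Definition lmon (r : R) (a : multideg n) : L := mkmalgU a r.

Definition lcoef (x : L) (a : multideg n) : R := mcoeff a x.

Definition lterm (r : R) (a : multideg n) (s : R) (b : multideg n) : L :=
  lmon (coc a b *: (r * sga a s)) (a + b).

Definition lmul (x y : L) : L :=
  \sum_(a <- msupp x) \sum_(b <- msupp y) lterm (lcoef x a) a (lcoef y b) b.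

Let lmonD a : {morph lmon^~ a : r s / r + s}.
Proof. exact: monalgUD. Qed.

Let lmon0 a : lmon 0 a = 0.
Proof. exact: monalgU0. Qed.

Let lterm0l a s b : lterm 0 a s b = 0.
Proof. by rewrite /lterm mul0r scaler0 lmon0. Qed.

Let lterm0r r a b : lterm r a 0 b = 0.
Proof. by rewrite /lterm raddf0 mulr0 scaler0 lmon0. Qed.

Let ltermDl a s b r r' : lterm (r + r') a s b = lterm r a s b + lterm r' a s b.
Proof. by rewrite /lterm mulrDl scalerDr lmonD. Qed.

Let ltermDr r a b s s' : lterm r a (s + s') b = lterm r a s b + lterm r a s' b.
Proof. by rewrite /lterm raddfD mulrDr scalerDr lmonD. Qed.

Let lmulw (d1 d2 : {fset multideg n}) (x y : L) :
  (msupp x `<=` d1)%fset -> (msupp y `<=` d2)%fset ->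
  lmul x y = \sum_(a <- d1) \sum_(b <- d2) lterm (lcoef x a) a (lcoef y b) b.
Proof.
move=> le1 le2; rewrite /lmul (big_fset_incl _ le1) /=.
  apply: eq_bigr => a _; apply: big_fset_incl => // b _ /mcoeff_outdom h.
  by rewrite /lcoef h lterm0r.
move=> a _ /mcoeff_outdom h.
by rewrite big1 // => b _; rewrite /lcoef h lterm0l.
Qed.

Let lmul0l : left_zero 0 lmul.
Proof. by move=> x; rewrite /lmul msupp0 big_seq_fset0. Qed.

Let lmul0r : right_zero 0 lmul.
Proof. by move=> x; rewrite /lmul big1 // => a _; rewrite msupp0 big_seq_fset0. Qed.

Lemma lmulDl : left_distributive lmul +%R.
Proof.
move=> x y z; rewrite (lmulw (msuppD_le x y) (fsubset_refl _)).
rewrite (lmulw (fsubsetUl _ (msupp y)) (fsubset_refl _)).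
rewrite (lmulw (fsubsetUr (msupp x) _) (fsubset_refl _)) -big_split /=.
apply: eq_bigr => a _; rewrite -big_split /=; apply: eq_bigr => b _.
by rewrite -ltermDl; congr lterm; exact: mcoeffD.
Qed.

Lemma lmulDr : right_distributive lmul +%R.
Proof.
move=> z x y; rewrite (lmulw (fsubset_refl _) (msuppD_le x y)).
rewrite (lmulw (fsubset_refl _) (fsubsetUl _ (msupp y))).
rewrite (lmulw (fsubset_refl _) (fsubsetUr (msupp x) _)) -big_split /=.
apply: eq_bigr => a _; rewrite -big_split /=; apply: eq_bigr => b _.
by rewrite -ltermDr; congr lterm; exact: mcoeffD.
Qed.

Let lmulUU r a s b : lmul (lmon r a) (lmon s b) = lterm r a s b.
Proof.
rewrite (lmulw (@msuppU_le _ _ a r) (@msuppU_le _ _ b s)) !big_seq_fset1.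
by rewrite /lcoef !mcoeffUU.
Qed.

Let lmulsl I (s : seq I) (F : I -> L) y :
  lmul (\sum_(i <- s) F i) y = \sum_(i <- s) lmul (F i) y.
Proof. exact: (big_morph (lmul^~ y) (fun u v => lmulDl u v y) (lmul0l y)). Qed.

Let lmulsr I (s : seq I) (F : I -> L) y :
  lmul y (\sum_(i <- s) F i) = \sum_(i <- s) lmul y (F i).
Proof. exact: (big_morph (lmul y) (lmulDr y) (lmul0r y)). Qed.

Lemma lmonE (x : L) : x = \sum_(a <- msupp x) lmon (lcoef x a) a.
Proof. exact: monalgE. Qed.

Lemma lmulA : associative lmul.
Proof.
move=> x y z; rewrite (lmonE x) !lmulsl; apply: eq_bigr => a _.
rewrite (lmonE y) lmulsl !lmulsr lmulsl; apply: eq_bigr => b _.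
rewrite (lmonE z) !lmulsr; apply: eq_bigr => c _.
rewrite !lmulUU /lterm.
congr (lmon _ _); last exact: addrA.
rewrite sigma_degZ sigma_degM -sigma_degD -scalerAr -scalerAl !scalerA mulrA.
by rewrite cocycleDl cocycleDr -mulrA mulrC.
Qed.

Lemma lmul1l : left_id (lmon 1 0) lmul.
Proof.
move=> x; rewrite {1}(lmonE x) lmulsr [RHS]lmonE; apply: eq_bigr => a _.
by rewrite lmulUU /lterm cocycle0l scale1r mul1r sigma_deg0 add0r.
Qed.

Lemma lmul1r : right_id (lmon 1 0) lmul.
Proof.
move=> x; rewrite {1}(lmonE x) lmulsl [RHS]lmonE; apply: eq_bigr => a _.
by rewrite lmulUU /lterm cocycle0r scale1r sigma_deg1 mulr1 addr0.
Qed.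

Lemma lone_neq0 : lmon 1 0 != 0.
Proof. by rewrite monalgU_eq0 oner_eq0. Qed.

HB.instance Definition _ := GRing.Zmodule_isNzRing.Build L
  lmulA lmul1l lmul1r lmulDl lmulDr lone_neq0.

Lemma lmonM r a s b :
  lmon r a * lmon s b = lmon (coc a b *: (r * sga a s)) (a + b).
Proof. exact: lmulUU. Qed.

Definition lconst (r : R) : L := lmon r 0.

Definition tgen (i : 'I_n) : L := lmon 1 (unitdeg i 1).

Definition tgenV (i : 'I_n) : L := lmon 1 (unitdeg i (-1)).

Definition tgenX (i : 'I_n) (m : int) : L :=
  match m with
  | Posz k => tgen i ^+ k
  | Negz k => tgenV i ^+ k.+1
  end.

Definition tmon (a : multideg n) : L := \prod_(i < n) tgenX i (a i).

(* The following facts show that the twisted multiplication is the one of the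
   algebra generated over R by the t_i^{+-1} subject to
   t_i^{+-1} r = sigma_i^{+-1}(r) t_i^{+-1} and t_k t_i = p_ik t_i t_k, with
   the ordered monomials [tmon a] as a basis of left R-module. *)

Lemma lconst_zmod_morphism : zmod_morphism lconst.
Proof. exact: monalgUB. Qed.

Lemma lconst_monoid_morphism : monoid_morphism lconst.
Proof.
split=> // r s.
by rewrite /lconst lmonM cocycle0l scale1r sigma_deg0 addr0.
Qed.

HB.instance Definition _ :=
  GRing.isZmodMorphism.Build R L lconst lconst_zmod_morphism.
HB.instance Definition _ :=
  GRing.isMonoidMorphism.Build R L lconst lconst_monoid_morphism.

Let unitdegD i m l : unitdeg i m + unitdeg i l = unitdeg i (m + l) :> multideg n.
Proof. by apply/ffunP => j; rewrite !ffunE; case: ifP; rewrite ?addr0. Qed.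

Let unitdeg0 i : unitdeg i 0 = 0 :> multideg n.
Proof. by apply/ffunP => j; rewrite !ffunE; case: ifP. Qed.

Let lmon_unitM i m l :
  lmon 1 (unitdeg i m) * lmon 1 (unitdeg i l) = lmon 1 (unitdeg i (m + l)).
Proof.
by rewrite lmonM cocycle_unit ltnn scale1r sigma_deg1 mulr1 unitdegD.
Qed.

Lemma tgenVK i : tgen i * tgenV i = 1.
Proof. by rewrite lmon_unitM subrr unitdeg0. Qed.

Lemma tgenK i : tgenV i * tgen i = 1.
Proof. by rewrite lmon_unitM addNr unitdeg0. Qed.

Lemma tgen_const i r :
  tgen i * lconst r = lconst (laurent_sigma D i r) * tgen i.
Proof.
rewrite !lmonM cocycle0r cocycle0l !scale1r mul1r sigma_deg1 mulr1.
by rewrite sigma_deg_unit addr0 add0r.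
Qed.

Lemma tgenV_const i r :
  tgenV i * lconst r = lconst (laurent_sigmaV D i r) * tgenV i.
Proof.
rewrite !lmonM cocycle0r cocycle0l !scale1r mul1r sigma_deg1 mulr1.
by rewrite sigma_deg_unit addr0 add0r.
Qed.

Lemma tgenC i k : i != k ->
  tgen k * tgen i = lconst (laurent_p D i k)%:A * (tgen i * tgen k).
Proof.
move=> ik; rewrite !lmonM !sigma_deg1 !mulr1 cocycle0l scale1r sigma_deg0.
rewrite add0r [unitdeg k 1 + _]addrC; congr (lmon _ _).
rewrite !cocycle_unit mulr1 !expr1z.
have := ik; rewrite neq_ltn => /orP[lt|lt]; rewrite lt ltnNge (ltnW lt) /=.
  by rewrite scale1r mulr1.
by rewrite scale1r -scalerAl mul1r scalerA laurent_p_antisym mulVf ?laurent_p_neq0 ?scale1r.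
Qed.

Lemma tgenXE i m : tgenX i m = lmon 1 (unitdeg i m).
Proof.
case: m => k; rewrite /tgenX.
  elim: k => [|k IH]; first by rewrite unitdeg0.
  by rewrite exprS IH lmon_unitM -PoszD.
rewrite NegzE; elim: k => [|k IH]; first by rewrite expr1.
by rewrite exprS IH lmon_unitM -opprD -PoszD.
Qed.

Lemma tmonE a : tmon a = lmon 1 a.
Proof.
pose part (m : nat) : multideg n := [ffun j : 'I_n => if (j < m)%N then a j else 0].
pose F (j : nat) : L := if insub j is Some i then tgenX i (a i) else 1.
have h m : (m <= n)%N -> \prod_(j < m) F j = lmon 1 (part m).
  elim: m => [_|m IH mn].
    by rewrite big_ord0; congr (lmon 1 _); apply/ffunP => j; rewrite !ffunE.
  rewrite big_ord_recr IH ?(ltnW mn) //= /F insubT tgenXE lmonM sigma_deg1 mulr1.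
  have -> : coc (part m) (unitdeg (Ordinal mn) (a (Ordinal mn))) = 1.
    apply: big1 => i _; apply: big1 => k ik; rewrite !ffunE.
    case: eqVneq ik => [-> /= ik|_ _]; last by rewrite mulr0 expr0z.
    by rewrite ltnNge (ltnW ik) mul0r expr0z.
  rewrite scale1r; congr (lmon 1 _); apply/ffunP => j; rewrite !ffunE -val_eqE /=.
  rewrite ltnS [in RHS]leq_eqVlt; case: (eqVneq (val j) m) => [jm|_] /=.
    by rewrite jm ltnn add0r; congr (a _); apply: val_inj; rewrite SubK.
  by rewrite addr0.
rewrite /tmon (eq_bigr (fun i : 'I_n => F i)) => [|i _]; last by rewrite /F valK.
by rewrite h //; congr (lmon 1 _); apply/ffunP => j; rewrite ffunE ltn_ord.
Qed.

Lemma lconst_tmon r a : lconst r * tmon a = lmon r a.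
Proof. by rewrite tmonE lmonM cocycle0l scale1r sigma_deg0 mulr1 add0r. Qed.

Lemma lcoefP (x y : L) : (forall a, lcoef x a = lcoef y a) <-> x = y.
Proof. exact: malgP. Qed.

Lemma laurentE (x : L) :
  x = \sum_(a <- msupp x) lconst (lcoef x a) * tmon a.
Proof. by rewrite {1}(lmonE x); apply: eq_bigr => a _; rewrite lconst_tmon. Qed.

End Laurent.

Section BellRogalski.
Variables (K : fieldType) (R : algType K) (n : nat) (D : laurentData R n).
Variables H J : 'I_n -> set R.

Local Notation sg := (laurent_sigma D).

(* [BR_ideal1 i m] is I_i^{(m)}, where [Negz k] is the integer -(k + 1):
   J_i sigma_i(J_i) ... sigma_i^{m-1}(J_i) for m >= 0, and
   sigma_i^{-1}(H_i) ... sigma_i^{m}(H_i) for m < 0. *)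
Definition BR_ideal1 (i : 'I_n) (m : int) : set R :=
  match m with
  | Posz k => \big[@idealM R/setT]_(j < k) (sigmaX D i j%:Z @` J i)
  | Negz k => \big[@idealM R/setT]_(j < k.+1) (sigmaX D i (- j.+1%:Z) @` H i)
  end.

Definition BR_ideal (a : multideg n) : set R :=
  \big[@idealM R/setT]_(i < n) BR_ideal1 i (a i).

Record BR_conditions : Prop := BRConditions {
  BR_idealH : forall i, ideal_of setT (H i);
  BR_idealJ : forall i, ideal_of setT (J i);
  BR_sigmaH : forall i k, i != k -> sg i @` H k = H k;
  BR_sigmaJ : forall i k, i != k -> sg i @` J k = J k;
  BR_commHH : forall i k, i != k -> idealM (H i) (H k) = idealM (H k) (H i);
  BR_commHJ : forall i k, i != k -> idealM (H i) (J k) = idealM (J k) (H i);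
  BR_commJJ : forall i k, i != k -> idealM (J i) (J k) = idealM (J k) (J i);
  BR_ideal_neq0 : forall i m, BR_ideal1 i m <> [set 0]
}.

Definition BR_algebra : set (skew_laurent D) :=
  [set x | forall a, BR_ideal a (lcoef x a)].

(* R, identified with the component of degree 0. *)
Definition BR_base : set (skew_laurent D) := range (@lconst K R n D).

(* The group Gamma. *)
Definition BR_group : set (R -> R) :=
  gen_subgroup [set g | exists i, g = sg i :> (R -> R)].

(* The set X of the elements a t^alpha with alpha > 0, and of 1, minus 0. *)
Definition BR_test : set (skew_laurent D) :=
  ([set x | exists a r, [/\ BR_ideal a r, pos_deg a & x = lconst D r * tmon D a]]
     `|` [set 1]) `\ 0.

End BellRogalski.

Arguments BR_ideal1 {K R n} D H J i m _.
Arguments BR_ideal {K R n} D H J a _.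
Arguments BR_algebra {K R n} D H J _.
Arguments BR_base {K R n} D _.
Arguments BR_group {K R n} D _.
Arguments BR_test {K R n} D H J _.

(* Main.v *)
Require Import Defs.
From mathcomp Require Import all_boot all_order all_algebra.
From mathcomp Require Import finmap boolp classical_sets monalg.

(** Write B for the algebra, with its grading by the multidegrees, and L for
    the ambient skew Laurent ring.

    That B is a subring of L amounts to the inclusion of
    I^(a) sigma^a(I^(b)) in I^(a+b) ([BR_idealM]), which reduces to rank one
    because sigma_i stabilises H_k and J_k for i != k.

    If B is simple, condition (1) is immediate.  A Gamma-stable ideal I of R
    gives the two-sided ideal of the elements of B whose coefficients lie in
    I, so I is 0 or R.  The homogeneous components of a central element z are
    central; if such a component u were nonzero of degree a != 0, then u - 1
    would be central and nonzero, hence invertible; but comparing coefficients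
    along the line Z a in (u - 1) y = 1 forces y to have infinite support
    ([mon_sub1_not_unit]), as R is a domain.

    Conversely, take a nonzero x in a nonzero ideal I of B.  In rank 0,
    Gamma-simplicity is the simplicity of R = B.  In positive rank,
    multiplying x by a homogeneous element brings one term x_a t^a of x into
    a degree a > 0, so (1) writes 1 as a sum of products u (x_a t^a) v.
    Replacing x_a t^a by x in those products and keeping the homogeneous u
    and v of total degree -a yields y in I with constant term 1, whose
    support is at most a translate of that of x ([normalize]).  If y is
    central then (3) gives y = 1.  Otherwise some homogeneous h in B has
    h y - y h != 0; the terms coming from the constant term 1 cancel, so this
    element of I has a smaller support, and an induction on the size of the
    support concludes ([ideal_full_of_supported]). *)

Set Implicit Arguments.
Unset Strict Implicit.
Unset Printing Implicit Defensive.

Import Order.TTheory GRing.Theory Num.Theory.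

Local Open Scope classical_set_scope.
Local Open Scope ring_scope.

(** * Subgroups and products of ideals *)

Section AdditiveSets.
Variable V : zmodType.
Implicit Types P : set V.

(** Most of the inclusions below are proved on additive generators: products,
    or homogeneous elements.  The target has to be an additive subgroup. *)
Definition additive_set P : Prop :=
  P 0 /\ forall x y, P x -> P y -> P (x - y).

Lemma additive_setD P x y : additive_set P -> P x -> P y -> P (x + y).
Proof.
by case=> P0 PB Px Py; rewrite -[y]opprK -[- y]sub0r; apply: (PB) => //; apply: PB.
Qed.

Lemma additive_set_sum P (T : eqType) (s : seq T) (F : T -> V) :
  additive_set P -> (forall i, i \in s -> P (F i)) -> P (\sum_(i <- s) F i).
Proof.
move=> aP PF; rewrite big_seq; elim/big_ind: _ => //; first by case: aP.
by move=> x y; exact: additive_setD.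
Qed.

End AdditiveSets.

Lemma additive_set_preim (W V : zmodType) (P : set V) (f : W -> V) :
  additive_set P -> {morph f : x y / x - y} -> additive_set (f @^-1` P).
Proof.
case=> P0 PB fB; split=> [|x y Px Py]; last by rewrite /preimage /= fB; exact: PB.
by rewrite /preimage /= -(subrr 0) fB subrr.
Qed.


Lemma ideal_additive (A : pzRingType) (S I : set A) :
  ideal_of S I -> additive_set I.
Proof. by case. Qed.

Lemma additive_centralizer (A : pzRingType) (z : A) :
  additive_set [set s | z * s = s * z].
Proof.
by split=> [|s t] /=; rewrite ?mulr0 ?mul0r // mulrBr mulrBl => -> ->.
Qed.

Section IdealProducts.
Variable R : comPzRingType.
Implicit Types I J P : set R.

Lemma idealMl I r x : ideal_of setT I -> I x -> I (r * x).
Proof. by case=> _ _ _ h Ix; case: (h r x). Qed.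

Lemma idealMr I r x : ideal_of setT I -> I x -> I (x * r).
Proof. by case=> _ _ _ h Ix; case: (h r x). Qed.

Lemma ideal_preim (f g : R -> R) I : ideal_of setT I ->
  {morph f : x y / x - y} -> (forall r x, f (r * x) = g r * f x) ->
  ideal_of setT (f @^-1` I).
Proof.
move=> iI fB fM; have [I0 IB] := additive_set_preim (ideal_additive iI) fB.
split=> // r x _ Ix; rewrite (mulrC x) /preimage /= fM.
by split; exact: idealMl.
Qed.

Lemma mem_idealM I J x y : I x -> J y -> idealM I J (x * y).
Proof.
move=> Ix Jy; exists [:: (x, y)]; last by rewrite big_seq1.
by move=> u; rewrite inE => /eqP->.
Qed.

Lemma idealM_sub I J P : additive_set P ->
  (forall x y, I x -> J y -> P (x * y)) -> idealM I J `<=` P.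
Proof.
move=> aP h _ [s sIJ ->]; apply: additive_set_sum => // u /sIJ[]; exact: h.
Qed.

Lemma ideal_idealM I J : ideal_of setT I -> ideal_of setT (idealM I J).
Proof.
move=> iI; have Ml r x : idealM I J x -> idealM I J (r * x).
  case=> s sIJ ->; exists [seq (r * u.1, u.2) | u <- s].
    by move=> _ /mapP[u /sIJ[Iu Ju] ->]; split=> //; exact: idealMl.
  by rewrite big_map mulr_sumr; apply: eq_bigr => u _; rewrite mulrA.
split=> //.
- by exists [::] => //; rewrite big_nil.
- move=> x y [s sIJ ->] Jy; rewrite -mulN1r.
  have [t tIJ ->] := Ml (-1) y Jy; exists (s ++ t); last by rewrite big_cat.
  by move=> u; rewrite mem_cat => /orP[/sIJ|/tIJ].
- by move=> r x _ IJx; rewrite (mulrC x); split; exact: Ml.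
Qed.

Section Families.
Variables (T : eqType) (F : T -> set R).
Hypothesis iF : forall i, ideal_of setT (F i).

Lemma ideal_bigidealM s : ideal_of setT (\big[@idealM R/setT]_(i <- s) F i).
Proof.
by case: s => [|i s]; rewrite ?big_nil ?big_cons //; exact: ideal_idealM.
Qed.

Lemma prod_in_bigidealM s (x : T -> R) : (forall i, F i (x i)) ->
  (\big[@idealM R/setT]_(i <- s) F i) (\prod_(i <- s) x i).
Proof.
move=> Fx; elim: s => [|i s IH]; rewrite ?big_nil ?big_cons //.
exact: mem_idealM.
Qed.

(** A product of ideals is the smallest ideal that contains the products of
    elements, one from each factor.  All the computations with I^(a) go
    through this characterisation, since [idealM] is a monoid law only on
    ideals and the generic theory of iterated operators does not apply. *)
Lemma bigidealM_sub s P : uniq s -> ideal_of setT P ->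
  (forall x : T -> R, (forall i, F i (x i)) -> P (\prod_(i <- s) x i)) ->
  \big[@idealM R/setT]_(i <- s) F i `<=` P.
Proof.
elim: s P => [P _ iP h r _|i s IH P /= /andP[iNs us] iP h].
  have F0 i : F i 0 by case: (iF i).
  by rewrite -[r]mulr1; apply: idealMl => //; have := h _ F0; rewrite big_nil.
rewrite big_cons; apply: idealM_sub; first exact: ideal_additive iP.
move=> u v Fu; move: v.
(* [u] enters the family at index [i], which does not occur in [s]. *)
apply: (IH [set v | P (u * v)]) => // [|x Fx].
  by apply: (@ideal_preim ( *%R u) id) => // [v w|v w]; rewrite (mulrBr, mulrCA).
have /h : forall j, F j (if j == i then u else x j).
  by move=> j; case: eqP => // ->.
rewrite big_cons eqxx; congr (P (u * _)); apply: eq_big_seq => j js.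
by case: eqP js iNs => // -> ->.
Qed.

End Families.

(** The iterated product unfolds from the left; commutativity is what allows
    it to be peeled off from the right, where a factor is added when the
    exponent moves away from 0. *)
Lemma bigidealM_recr (F : nat -> set R) k :
  (forall j, ideal_of setT (F j)) ->
  \big[@idealM R/setT]_(j < k.+1) F j =
  idealM (\big[@idealM R/setT]_(j < k) F j) (F k).
Proof.
move=> iF; rewrite -!(big_mkord xpredT F) /index_iota !subn0.
apply/seteqP; split.
  apply: bigidealM_sub => //; rewrite ?iota_uniq //.
    by apply: ideal_idealM; exact: ideal_bigidealM.
  move=> x Fx; rewrite -addn1 iotaD big_cat big_seq1 /=.
  by apply: mem_idealM => //; exact: prod_in_bigidealM.
apply: idealM_sub => [|u v Fu Fv].
  by apply: ideal_additive; exact: ideal_bigidealM.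
move: u Fu; apply: bigidealM_sub => //; rewrite ?iota_uniq //.
  apply: (@ideal_preim (fun u => u * v) id).
  - exact: ideal_bigidealM.
  - by move=> u w; rewrite mulrBl.
  - by move=> u w; rewrite mulrA.
move=> x Fx; have : forall j, F j (if j == k then v else x j).
  by move=> j; case: eqP => // ->.
move/(prod_in_bigidealM (iota 0 k.+1)).
rewrite -[in X in _ X]addn1 iotaD big_cat big_seq1 /= add0n eqxx.
suff -> : \prod_(j <- iota 0 k) (if j == k then v else x j) =
          \prod_(j <- iota 0 k) x j by [].
by apply: eq_big_seq => j; rewrite mem_iota; case: eqP => // ->; rewrite add0n ltnn.
Qed.

End IdealProducts.

(** * The ideals I^(a) *)

Section GradedIdeals.
Variables (K : fieldType) (R : comAlgType K) (n : nat) (D : laurentData R n).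
Variables H J : 'I_n -> set R.

Local Notation I1 := (BR_ideal1 D H J).
Local Notation IB := (BR_ideal D H J).
Local Notation sga := (sigma_deg D).

Lemma sigmaXK i m : cancel (sigmaX D i m) (sigmaX D i (- m)).
Proof. by move=> r; rewrite -sigmaXD addNr. Qed.

Lemma sigmaXVK i m : cancel (sigmaX D i (- m)) (sigmaX D i m).
Proof. by move=> r; rewrite -sigmaXD subrr. Qed.

Lemma sigma_degK a : cancel (sga a) (sga (- a)).
Proof. by move=> r; rewrite -sigma_degD addNr sigma_deg0. Qed.

Lemma sigma_deg_inj a : injective (sga a).
Proof. exact: can_inj (@sigma_degK a). Qed.

Lemma ideal_sigmaX i m (I : set R) :
  ideal_of setT I -> ideal_of setT (sigmaX D i m @` I).
Proof.
move=> iI; have -> : sigmaX D i m @` I = sigmaX D i (- m) @^-1` I.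
  apply/seteqP; split=> [_ [x Ix <-]|y Iy]; first by rewrite /preimage /= sigmaXK.
  by exists (sigmaX D i (- m) y); rewrite ?sigmaXVK.
by apply: ideal_preim => //; [exact: sigmaXB|exact: sigmaXM].
Qed.

Hypothesis BR : BR_conditions D H J.

Let iH := BR_idealH BR.
Let iJ := BR_idealJ BR.

Lemma ideal_BR_ideal1 i m : ideal_of setT (I1 i m).
Proof. by case: m => k; apply: ideal_bigidealM => j; exact: ideal_sigmaX. Qed.

Lemma ideal_BR_ideal a : ideal_of setT (IB a).
Proof. by apply: ideal_bigidealM => i; exact: ideal_BR_ideal1. Qed.

Lemma BR_ideal1_pos i (k : nat) :
  I1 i k.+1%:Z = idealM (I1 i k) (sigmaX D i k @` J i).
Proof.
by apply: (bigidealM_recr (F := fun j => sigmaX D i j%:Z @` J i)) => j; exact: ideal_sigmaX.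
Qed.

Lemma BR_ideal1_neg i (k : nat) :
  I1 i (- k.+1%:Z) = idealM (I1 i (- k%:Z)) (sigmaX D i (- k.+1%:Z) @` H i).
Proof.
have iF j : ideal_of setT (sigmaX D i (- j.+1%:Z) @` H i) by exact: ideal_sigmaX.
apply: etrans (bigidealM_recr (F := fun j => sigmaX D i (- j.+1%:Z) @` H i) k iF) _.
by case: k => [|k] //=; rewrite !big_ord0.
Qed.

(** In negative degree the index moves towards 0: a factor is dropped, which
    only enlarges the ideal. *)
Lemma BR_ideal1_up i m x y : I1 i m x -> J i y ->
  I1 i (m + 1) (x * sigmaX D i m y).
Proof.
case: m => [k|k] Ix Jy.
  rewrite -PoszD addn1 BR_ideal1_pos; apply: mem_idealM => //.
apply: idealMr; first exact: ideal_BR_ideal1.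
have -> : Negz k + 1 = - k%:Z by rewrite NegzE -addn1 PoszD opprD subrK.
move: x Ix; rewrite NegzE BR_ideal1_neg.
apply: idealM_sub => [|x z Ix _]; first exact: ideal_additive (ideal_BR_ideal1 _ _).
by apply: idealMr => //; exact: ideal_BR_ideal1.
Qed.

Lemma BR_ideal1_down i m x y : I1 i m x -> H i y ->
  I1 i (m - 1) (x * sigmaX D i (m - 1) y).
Proof.
have neg k : I1 i (- k%:Z) x -> H i y ->
    I1 i (- k%:Z - 1) (x * sigmaX D i (- k%:Z - 1) y).
  move=> Ix Hy; rewrite -opprD -PoszD addn1 BR_ideal1_neg.
  by apply: mem_idealM => //; exists y.
case: m => [[|k]|k] Ix Hy; [exact: (neg 0)| |exact: (neg k.+1)].
apply: idealMr; first exact: ideal_BR_ideal1.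
rewrite -addn1 PoszD addrK.
move: x Ix {neg}; rewrite BR_ideal1_pos.
apply: idealM_sub => [|x z Ix _]; first exact: ideal_additive (ideal_BR_ideal1 _ _).
by apply: idealMr => //; exact: ideal_BR_ideal1.
Qed.

(** Adding the factors of I_i^(l) to x one at a time moves the exponent from m
    to m + l by unit steps, upwards with J_i or downwards with H_i, whatever
    the signs of m and l. *)
Lemma BR_ideal1M i m l x y : I1 i m x -> I1 i l y ->
  I1 i (m + l) (x * sigmaX D i m y).
Proof.
move=> Ix; pose Q k := [set y | I1 i k (x * sigmaX D i m y)].
have iQ k : ideal_of setT (Q k).
  apply: (ideal_preim (f := fun y => x * sigmaX D i m y) (g := sigmaX D i m)).
  - exact: ideal_BR_ideal1.
  - by move=> u v; rewrite sigmaXB mulrBr.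
  - by move=> u v; rewrite sigmaXM mulrCA.
move: y; elim/int_rec: l => [y _|k IH|k IH].
- by rewrite addr0; apply: idealMr => //; exact: ideal_BR_ideal1.
- rewrite BR_ideal1_pos; apply: (idealM_sub (ideal_additive (iQ _))) => u _ Iu [v Jv <-].
  rewrite /Q /mkset sigmaXM mulrA -sigmaXD -addn1 PoszD addrA.
  by apply: BR_ideal1_up => //; exact: IH.
- rewrite BR_ideal1_neg; apply: (idealM_sub (ideal_additive (iQ _))) => u _ Iu [v Jv <-].
  rewrite /Q /mkset sigmaXM mulrA -sigmaXD -addn1 PoszD opprD addrA.
  by apply: BR_ideal1_down => //; exact: IH.
Qed.

Lemma sigmaX_stable i m (I : set R) :
  laurent_sigma D i @` I = I -> forall x, I x -> I (sigmaX D i m x).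
Proof.
move=> sI.
have s1 x : I x -> I (laurent_sigma D i x) by move=> Ix; rewrite -sI; exists x.
have s2 x : I x -> I (laurent_sigmaV D i x).
  by rewrite -{1}sI => -[y Iy <-]; rewrite laurent_sigmaK.
case: m => k x Ix; rewrite /sigmaX; [elim: k|elim: k.+1] => //= {}k; first exact: s1.
exact: s2.
Qed.

Lemma sigmaX_BR_ideal1 i k m l x : i != k -> I1 k l x ->
  I1 k l (sigmaX D i m x).
Proof.
move=> ik; move: x.
(* Both signs of the exponent are products of translates of one ideal fixed
   by sigma_i; these translations commute with sigma_i. *)
have main (G : set R) (e : nat -> int) N :
    laurent_sigma D i @` G = G -> ideal_of setT G ->
    \big[@idealM R/setT]_(j < N) (sigmaX D k (e j) @` G) `<=`
    sigmaX D i m @^-1` (\big[@idealM R/setT]_(j < N) (sigmaX D k (e j) @` G)).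
  move=> sG iG; have iF (j : 'I_N) : ideal_of setT (sigmaX D k (e j) @` G).
    exact: ideal_sigmaX.
  apply: bigidealM_sub => // [||x Fx].
  - exact: index_enum_uniq.
  - apply: (ideal_preim (g := sigmaX D i m)); first exact: ideal_bigidealM.
      exact: sigmaXB.
    exact: sigmaXM.
  - rewrite /preimage /= (big_morph _ (@sigmaXM _ _ _ D i m) (@sigmaX1 _ _ _ D i m)).
    apply: prod_in_bigidealM => j; have [y Gy <-] := Fx j.
    by exists (sigmaX D i m y); [exact: sigmaX_stable|exact: sigmaXC].
case: l => N.
  by apply: (main (J k) (fun j => j%:Z)) => //; exact: (BR_sigmaJ BR).
by apply: (main (H k) (fun j => - j.+1%:Z)) => //; exact: (BR_sigmaH BR).
Qed.

Lemma sigma_deg_BR_ideal1 (a : multideg n) k l x : a k = 0 -> I1 k l x -> I1 k l (sga a x).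
Proof.
move=> ak Ix; rewrite /sigma_deg; elim: (enum _) => //= i s IH.
by have [->|ik] := eqVneq i k; [rewrite ak|exact: sigmaX_BR_ideal1].
Qed.

(** Up to automorphisms that stabilise I_i^(l), sigma^a acts on it as
    sigma_i^(a_i). *)
Lemma BR_ideal1M_deg (a : multideg n) i l x y : I1 i (a i) x -> I1 i l y ->
  I1 i (a i + l) (x * sga a y).
Proof.
move=> Ix Iy; rewrite -[a in sga a](subrK (unitdeg i (a i))) [in sga _]addrC.
rewrite sigma_degD sigma_deg_unit; apply: BR_ideal1M => //.
by apply: sigma_deg_BR_ideal1; rewrite // !ffunE eqxx subrr.
Qed.

Lemma BR_idealM a b x y : IB a x -> IB b y -> IB (a + b) (x * sga a y).
Proof.
have i1 c i : ideal_of setT (I1 i (c i)) by exact: ideal_BR_ideal1.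
have iab := ideal_BR_ideal (a + b).
move=> Ia Ib; move: x Ia; apply: bigidealM_sub => //.
- exact: index_enum_uniq.
- apply: (ideal_preim (f := fun x => x * sga a y) (g := id)) => // u v.
    by rewrite mulrBl.
  by rewrite mulrA.
move=> x Fx; move: y Ib; apply: bigidealM_sub => //.
- exact: index_enum_uniq.
- apply: (ideal_preim (f := fun y => \prod_i x i * sga a y) (g := sga a)) => // u v.
    by rewrite raddfB mulrBr.
  by rewrite sigma_degM mulrCA.
move=> y Fy; rewrite (big_morph _ (@sigma_degM _ _ _ D a) (@sigma_deg1 _ _ _ D a)).
rewrite -big_split; apply: prod_in_bigidealM => // i.
by rewrite ffunE; exact: BR_ideal1M_deg.
Qed.

Lemma BR_ideal0 r : IB 0 r.
Proof.
rewrite -[r]mulr1; apply: idealMl; first exact: ideal_BR_ideal.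
have <- : \prod_(i < n) 1 = 1 :> R by rewrite big1.
by apply: prod_in_bigidealM => i; rewrite ffunE /= big_ord0.
Qed.

Hypothesis R_domain : forall x y : R, x * y = 0 -> x = 0 \/ y = 0.

Lemma BR_ideal_nonzero a : exists2 r, IB a r & r != 0.
Proof.
have h i : exists r, I1 i (a i) r /\ r != 0.
  apply: contrapT => no; apply: (@BR_ideal_neq0 _ _ _ _ _ _ BR i (a i)).
  have i1 := ideal_BR_ideal1 i (a i).
  apply/seteqP; split=> [r Ir|_ ->]; last by case: i1.
  by apply: contrapT => /eqP r0; apply: no; exists r.
have /choice[f fP] := h; exists (\prod_i f i).
  by apply: prod_in_bigidealM => i; case: (fP i).
elim/big_ind: _ => [|x y x0 y0|i _]; first exact: oner_neq0; last by case: (fP i).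
by apply/eqP => /R_domain[]; apply/eqP.
Qed.

End GradedIdeals.

(** * Coefficients of products with monomials *)

Section Monomials.
Variables (K : fieldType) (R : algType K) (n : nat) (D : laurentData R n).

Local Notation L := (skew_laurent D).
Local Notation sga := (sigma_deg D).
Local Notation coc := (cocycle D).
Implicit Types x y : L.

Lemma lcoefB a : {morph (fun x : L => lcoef x a) : x y / x - y}.
Proof. exact: mcoeffB. Qed.

Lemma lcoef_mon r a b : lcoef (lmon D r a) b = if b == a then r else 0.
Proof. by rewrite [LHS]mcoeffU eq_sym; case: eqP. Qed.

Lemma lcoef_const r b : lcoef (lconst D r) b = if b == 0 then r else 0.
Proof. exact: lcoef_mon. Qed.

Lemma lcoef0 a : lcoef (0 : L) a = 0.
Proof. exact: mcoeff0. Qed.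

Lemma lcoef_neq0 x : x != 0 -> exists a, lcoef x a != 0.
Proof.
move=> x0; apply: contrapT => no; move/eqP: x0; apply; apply/lcoefP => a.
by rewrite lcoef0; apply: contrapT => /eqP xa; apply: no; exists a.
Qed.

Lemma additive_set_lmon (P : set L) x : additive_set P ->
  (forall a, P (lmon D (lcoef x a) a)) -> P x.
Proof. by move=> aP h; rewrite (lmonE x); apply: additive_set_sum. Qed.

Lemma lcoef_monMl r c x b :
  lcoef (lmon D r c * x) (c + b) = coc c b *: (r * sga c (lcoef x b)).
Proof.
pose P := [set x | lcoef (lmon D r c * x) (c + b) =
                   coc c b *: (r * sga c (lcoef x b))].
apply: (@additive_set_lmon P) => [|a]; last first.
  rewrite /P /mkset lmonM !lcoef_mon (inj_eq (addrI c)); case: eqP => [->|_] //.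
  by rewrite raddf0 mulr0 scaler0.
split=> [|y z]; rewrite /P /mkset; first by rewrite mulr0 !lcoef0 raddf0 mulr0 scaler0.
by rewrite mulrBr !lcoefB raddfB mulrBr scalerBr => -> ->.
Qed.

Lemma lcoef_monMr s d x b :
  lcoef (x * lmon D s d) (b + d) = coc b d *: (lcoef x b * sga b s).
Proof.
pose P := [set x | lcoef (x * lmon D s d) (b + d) =
                   coc b d *: (lcoef x b * sga b s)].
apply: (@additive_set_lmon P) => [|a]; last first.
  rewrite /P /mkset lmonM !lcoef_mon (inj_eq (addIr d)); case: eqP => [->|_] //.
  by rewrite mul0r scaler0.
split=> [|y z]; rewrite /P /mkset; first by rewrite mul0r !lcoef0 mul0r scaler0.
by rewrite mulrBl !lcoefB mulrBl scalerBr => -> ->.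
Qed.

Lemma lcoef_sandwich r c x s d b :
  lcoef (lmon D r c * x * lmon D s d) (c + b + d) =
  coc (c + b) d *: (coc c b *: (r * sga c (lcoef x b)) * sga (c + b) s).
Proof. by rewrite lcoef_monMr lcoef_monMl. Qed.

Lemma cocycle_neq0 a b : coc a b != 0.
Proof.
apply/prodf_neq0 => i _; apply/prodf_neq0 => k _.
by rewrite expfz_neq0 ?laurent_p_neq0.
Qed.

(** The support is bounded by a list, and its size by that of the list, so
    that translating it or deleting a degree are operations on lists. *)
Definition supported (s : seq (multideg n)) x : Prop :=
  forall a, lcoef x a != 0 -> a \in s.

Lemma supported_msupp x : supported (msupp x) x.
Proof. by move=> a; rewrite [_ != 0]mcoeff_neq0. Qed.

Lemma multideg_mulrIn (a : multideg n) : a != 0 -> injective (GRing.natmul a).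
Proof.
move=> a0; have [i ai] : exists i, a i != 0.
  apply: contrapT => no; move/eqP: a0; apply; apply/ffunP => i; rewrite ffunE.
  by apply: contrapT => /eqP ai; apply: no; exists i.
by move=> k l /ffunP/(_ i); rewrite !ffunMnE; exact: mulrIn.
Qed.

Lemma finite_support_line x a b : a != 0 ->
  (forall k, lcoef x (b + a *+ k) != 0) -> False.
Proof.
move=> a0 nz; pose s := [seq b + a *+ k | k <- iota 0 (size (msupp x)).+1].
have : (size s <= size (msupp x))%N.
  apply: uniq_leq_size => [|c /mapP[k _ ->]]; last exact: supported_msupp.
  by rewrite map_inj_uniq ?iota_uniq // => k l /addrI/(multideg_mulrIn a0).
by rewrite size_map size_iota ltnn.
Qed.

End Monomials.

(** * The subalgebra *)

Section Algebra.
Variables (K : fieldType) (R : comAlgType K) (n : nat) (D : laurentData R n).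
Variables H J : 'I_n -> set R.
Hypothesis BR : BR_conditions D H J.

Local Notation L := (skew_laurent D).
Local Notation sga := (sigma_deg D).
Local Notation coc := (cocycle D).
Local Notation IB := (BR_ideal D H J).
Local Notation B := (BR_algebra D H J).
Implicit Types (x y z : L) (I : set L).

Lemma BR_algebra_mon r a : IB a r -> B (lmon D r a).
Proof.
move=> Ir b; rewrite lcoef_mon; case: eqP => [->|_] //.
by case: (ideal_BR_ideal BR b).
Qed.

Lemma BR_algebra_const r : B (lconst D r).
Proof. by apply: BR_algebra_mon; exact: BR_ideal0. Qed.

Lemma BR_algebra1 : B 1.
Proof. exact: BR_algebra_const. Qed.

Lemma BR_algebra_additive : additive_set B.
Proof.
split=> [a|x y Bx By a]; first by rewrite lcoef0; case: (ideal_BR_ideal BR a).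
by rewrite lcoefB; case: (ideal_BR_ideal BR a) => _ _ h _; exact: h.
Qed.

Lemma BR_algebra_sub (P : set L) : additive_set P ->
  (forall a r, IB a r -> P (lmon D r a)) -> B `<=` P.
Proof. by move=> aP h x Bx; apply: additive_set_lmon => // a; apply: h. Qed.

Lemma additive_mull (P : set L) y : additive_set P -> additive_set [set x | P (x * y)].
Proof. by move=> aP; apply: (additive_set_preim aP) => u v; rewrite mulrBl. Qed.

Lemma additive_mulr (P : set L) x : additive_set P -> additive_set [set y | P (x * y)].
Proof. by move=> aP; apply: (additive_set_preim aP) => u v; rewrite mulrBr. Qed.

Lemma BR_algebraM x y : B x -> B y -> B (x * y).
Proof.
have aB := BR_algebra_additive.
move=> Bx By; move: x Bx y By.
apply: (BR_algebra_sub (P := [set x | forall y, B y -> B (x * y)])).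
  split=> [y _|x z Bx Bz y By]; first by rewrite mul0r; case: aB.
  by rewrite mulrBl; case: aB => _; apply; [exact: Bx|exact: Bz].
move=> a r Ir; apply: BR_algebra_sub => [|b s Is]; first exact: additive_mulr.
rewrite /mkset lmonM; apply: BR_algebra_mon; rewrite -mulr_algl.
by apply: idealMl; [exact: ideal_BR_ideal|exact: BR_idealM].
Qed.

Lemma ideal_principal x : B x -> ideal_of B (principal B x).
Proof.
move=> Bx; split.
- move=> _ [s sB ->]; apply: additive_set_sum; first exact: BR_algebra_additive.
  by move=> u /sB[B1 B2]; do 2?apply: BR_algebraM.
- by exists [::] => //; rewrite big_nil.
- move=> _ _ [s sB ->] [t tB ->].
  exists (s ++ [seq (- u.1, u.2) | u <- t]).
    move=> u; rewrite mem_cat => /orP[/sB//|/mapP[v /tB[B1 B2] ->]]; split=> //=.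
    by rewrite -sub0r; case: BR_algebra_additive => B0; apply.
  by rewrite big_cat big_map -sumrN; congr (_ + _); apply: eq_bigr => u _; rewrite !mulNr.
- move=> b _ Bb [s sB ->]; split.
    exists [seq (b * u.1, u.2) | u <- s].
      by move=> _ /mapP[u /sB[B1 B2] ->]; split=> //; exact: BR_algebraM.
    by rewrite big_map mulr_sumr; apply: eq_bigr => u _; rewrite /= !mulrA.
  exists [seq (u.1, u.2 * b) | u <- s].
    by move=> _ /mapP[u /sB[B1 B2] ->]; split=> //; exact: BR_algebraM.
  by rewrite big_map mulr_suml; apply: eq_bigr => u _; rewrite /= !mulrA.
Qed.

Lemma principal_self x : principal B x x.
Proof.
exists [:: (1, 1)]; last by rewrite big_seq1 mul1r mulr1.
by move=> u; rewrite inE => /eqP->; split; exact: BR_algebra1.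
Qed.

Lemma ideal_eq_full I : ideal_of B I -> I 1 -> I = B.
Proof.
move=> [subI _ _ IM] I1; apply/seteqP; split=> // x Bx.
by rewrite -[x]mulr1; case: (IM x 1).
Qed.

Lemma BR_test_sub : BR_test D H J `<=` B.
Proof.
move=> x [[[a [r [Ir _ ->]]]|->] _]; last exact: BR_algebra1.
by rewrite lconst_tmon; exact: BR_algebra_mon.
Qed.

Lemma BR_algebra_homog x a : B x -> B (lmon D (lcoef x a) a).
Proof. by move=> Bx; apply: BR_algebra_mon. Qed.

(** Commuting with a homogeneous element is a condition on each component. *)
Lemma center_homog z a : center B z -> center B (lmon D (lcoef z a) a).
Proof.
case=> Bz zC; split=> [|s Bs]; first exact: BR_algebra_homog.
move: s Bs; apply: BR_algebra_sub => [|d r Ir]; first exact: additive_centralizer.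
have := zC _ (BR_algebra_mon Ir) => /(congr1 (fun x => lcoef x (a + d))).
by rewrite lcoef_monMr [in RHS]addrC lcoef_monMl !lmonM [d + a]addrC => ->.
Qed.

(** * Coefficients over a domain *)

Hypothesis R_domain : forall x y : R, x * y = 0 -> x = 0 \/ y = 0.

Lemma domain_mulf_neq0 (r s : R) : r != 0 -> s != 0 -> r * s != 0.
Proof. by move=> r0 s0; apply/eqP => /R_domain[]; apply/eqP. Qed.

Lemma lcoef_monMl_neq0 r c x b :
  r != 0 -> lcoef x b != 0 -> lcoef (lmon D r c * x) (c + b) != 0.
Proof.
move=> r0 xb; rewrite lcoef_monMl scaler_eq0 negb_or cocycle_neq0 /=.
apply: domain_mulf_neq0 => //.
by rewrite -(raddf0 (sga c)) (inj_eq (@sigma_deg_inj _ _ _ D c)).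
Qed.

Lemma lcoef_monMr_neq0 s d x b :
  s != 0 -> lcoef x b != 0 -> lcoef (x * lmon D s d) (b + d) != 0.
Proof.
move=> s0 xb; rewrite lcoef_monMr scaler_eq0 negb_or cocycle_neq0 /=.
apply: domain_mulf_neq0 => //.
by rewrite -(raddf0 (sga b)) (inj_eq (@sigma_deg_inj _ _ _ D b)).
Qed.

(** The equation says u y = y + 1 with u = r t^a.  Away from degree 0, the
    degrees b and a + b are simultaneously in the support of y.  In degree 0
    it puts 0 or -a in the support, which then contains a half-line. *)
Lemma mon_sub1_not_unit r a y : r != 0 -> a != 0 -> (lmon D r a - 1) * y <> 1.
Proof.
move=> r0 a0 yE.
have E b : lcoef (lmon D r a * y) (a + b) = lcoef y (a + b) + lcoef (1 : L) (a + b).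
  have -> : lmon D r a * y = y - (0 - 1) by rewrite sub0r opprK -[in RHS]yE mulrBl mul1r subrKC.
  by rewrite !lcoefB lcoef0 sub0r opprK.
have up b : a + b != 0 -> lcoef y b != 0 -> lcoef y (a + b) != 0.
  move=> ab /(lcoef_monMl_neq0 a r0).
  by rewrite E lcoef_const (negbTE ab) addr0.
have down b : a + b != 0 -> lcoef y (a + b) != 0 -> lcoef y b != 0.
  move=> ab; have := E b; rewrite lcoef_const (negbTE ab) addr0 => <-.
  by apply: contra_neq => yb; rewrite lcoef_monMl yb raddf0 mulr0 scaler0.
have tf k : a *+ k.+1 != 0 by rewrite -(mulr0n a) (inj_eq (multideg_mulrIn a0)).
have [y0|y0] := eqVneq (lcoef y 0) 0.
  have ya : lcoef y (- a) != 0.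
    apply/eqP => ya; have := E (- a); rewrite subrr y0 lcoef_const eqxx add0r.
    rewrite -(subrr a) lcoef_monMl ya raddf0 mulr0 scaler0 => /esym/eqP.
    by rewrite oner_eq0.
  apply: (@finite_support_line _ _ _ D y (- a) (- a)) => [|k]; first by rewrite oppr_eq0.
  elim: k => [|k IH]; first by rewrite mulr0n addr0.
  have e : a + (- a + (- a) *+ k.+1) = - a + (- a) *+ k by rewrite addNKr mulrS.
  by apply: down; rewrite e // -mulrS mulNrn oppr_eq0.
apply: (@finite_support_line _ _ _ D y a 0) => // k.
rewrite add0r; elim: k => [|k IH]; first by rewrite mulr0n.
by rewrite mulrS; apply: up; rewrite // -mulrS.
Qed.

(** * Simplicity implies the three conditions *)

Section SimpleImplies.
Hypothesis simpleB : simple_ring B.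

Lemma simple_ideal1 I x : ideal_of B I -> I x -> x != 0 -> I 1.
Proof.
move=> iI Ix /eqP x0; case: simpleB => _ /(_ I iI)[IE|->]; last exact: BR_algebra1.
by rewrite IE in Ix.
Qed.

Lemma simple_principal x : BR_test D H J x -> principal B x = B.
Proof.
move=> tx; have ip := ideal_principal (BR_test_sub tx).
apply: ideal_eq_full => //; apply: (simple_ideal1 ip (principal_self x)).
by case: tx => _ /eqP.
Qed.

(** The elements of the algebra with all coefficients in a Gamma-stable ideal
    form a two-sided ideal, which meets R in that ideal. *)
Lemma simple_gamma_simple : gamma_simple (BR_group D).
Proof.
move=> I iI invI; have [I0 subrI] := ideal_additive iI.
have sI i : laurent_sigma D i @` I = I by apply: invI; apply: gen_subgroup_in; exists i.
have sgaI a r : I r -> I (sga a r).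
  move=> Ir; rewrite /sigma_deg; elim: (enum _) => //= i s.
  exact: sigmaX_stable.
pose P := [set x | B x /\ forall a, I (lcoef x a)].
have aP : additive_set P.
  have [B0 BB] := BR_algebra_additive.
  split=> [|x y [Bx Ix] [By Iy]]; split; [done|by move=> a; rewrite lcoef0|exact: BB|].
  by move=> a; rewrite lcoefB; apply: subrI.
have iP : ideal_of B P.
  have [P0 PB] := aP; split=> // [x []//|b x Bb [Bx Ix]].
  split; (split; first exact: BR_algebraM).
    move: b Bb; apply: BR_algebra_sub.
      split=> [a|u v Pu Pv a]; first by rewrite mul0r lcoef0.
      by rewrite mulrBl lcoefB; apply: subrI.
    move=> c r _ a; rewrite -[a](subrKC c) lcoef_monMl -mulr_algl.
    by do 2!apply: idealMl => //; exact: sgaI.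
  move: b Bb; apply: BR_algebra_sub.
    split=> [a|u v Pu Pv a]; first by rewrite mulr0 lcoef0.
    by rewrite mulrBr lcoefB; apply: subrI.
  move=> d r _ a; rewrite -[a](subrK d) lcoef_monMr -mulr_algl.
  by apply: idealMl => //; exact: idealMr.
have [[r Ir r0]|no] := pselect (exists2 r, I r & r != 0); last first.
  left; apply/seteqP; split=> [r Ir|_ -> //].
  by apply: contrapT => /eqP r0; apply: no; exists r.
right; apply/seteqP; split=> // s _.
have /(simple_ideal1 iP)[|_ /(_ 0)] : P (lconst D r).
- split=> [|a]; first exact: BR_algebra_const.
  by rewrite lcoef_const; case: eqP.
- by rewrite monalgU_eq0.
- by rewrite lcoef_const eqxx -[s]mulr1 => ?; exact: idealMl.
Qed.

Lemma simple_center : center B `<=` BR_base D.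
Proof.
move=> z Cz; exists (lcoef z 0) => //; apply/lcoefP => a.
rewrite lcoef_const; case: eqVneq => [->//|a0]; apply/esym/eqP.
apply: contrapT => /negP za.
pose u := lmon D (lcoef z a) a - 1.
have [Bw wC] := center_homog a Cz.
have Cu : center B u.
  split=> [|s Bs]; last by rewrite mulrBl mulrBr mul1r mulr1 wC.
  by case: BR_algebra_additive => _; apply=> //; exact: BR_algebra1.
have [Bu uC] := Cu.
have iU : ideal_of B [set x | exists2 y, B y & x = u * y].
  have aB := BR_algebra_additive; have [B0 BB] := aB.
  split.
  - by move=> _ [y By ->]; exact: BR_algebraM.
  - by exists 0; rewrite ?mulr0.
  - by move=> _ _ [y By ->] [y' By' ->]; exists (y - y'); [exact: BB|rewrite mulrBr].
  - move=> s _ Bs [y By ->]; split.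
      by exists (s * y); rewrite ?mulrA ?uC //; exact: BR_algebraM.
    by exists (y * s); rewrite ?mulrA //; exact: BR_algebraM.
have [y _ /esym] : [set x | exists2 y, B y & x = u * y] 1.
  apply: (simple_ideal1 (x := u) iU).
    by exists 1; rewrite ?mulr1 //; exact: BR_algebra1.
  apply/eqP => /(congr1 (fun x => lcoef x 0)); rewrite lcoefB lcoef_mon lcoef_const.
  rewrite eq_sym (negbTE a0) eqxx lcoef0 sub0r => /eqP.
  by rewrite oppr_eq0 oner_eq0.
exact: mon_sub1_not_unit.
Qed.

End SimpleImplies.

(** * The three conditions imply simplicity *)

Section ConditionsImply.
Hypothesis test_full : forall x, BR_test D H J x -> principal B x = B.
Hypothesis gammaR : gamma_simple (BR_group D).
Hypothesis center_base : center B `<=` BR_base D.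

(** The identity 1 = sum of u (x_a t^a) v is turned into an element of I by
    putting x in place of its term x_a t^a. *)
Lemma normalize I x a : ideal_of B I -> I x -> pos_deg a -> lcoef x a != 0 ->
  exists y, [/\ I y, lcoef y 0 = 1 &
                forall b, lcoef y b != 0 -> lcoef x (b + a) != 0].
Proof.
move=> [subI I0 ID IM] Ix apos xa; pose x0 := lmon D (lcoef x a) a.
have x0a : lcoef x0 a = lcoef x a by rewrite lcoef_mon eqxx.
(* [P w] says that w agrees in degree 0 with an element of I whose support
   is constrained by x.  It holds for the products u (x_a t^a) v: for
   homogeneous u and v take u x v if the total degree is 0, else 0. *)
pose P (w : L) := exists y, [/\ I y, lcoef y 0 = lcoef w 0 &
                        forall b, lcoef y b != 0 -> lcoef x (b + a) != 0].
have Bx := subI _ Ix.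
have aP : additive_set P.
  split=> [|u v [y [Iy yu yx]] [z [Iz zv zx]]].
    by exists 0; split=> // b; rewrite lcoef0 eqxx.
  exists (y - z); split; [exact: ID|by rewrite !lcoefB yu zv|move=> b].
  apply: contraNneq => xb; rewrite lcoefB.
  have [/yx|/negPn/eqP->] := boolP (lcoef y b != 0); first by rewrite xb eqxx.
  have [/zx|/negPn/eqP->] := boolP (lcoef z b != 0); first by rewrite xb eqxx.
  by rewrite subrr.
suff /(_ 1 (@BR_algebra1))[y [Iy y1 yx]] : forall w, B w -> P w.
  by exists y; split=> //; rewrite y1 lcoef_const eqxx.
have tx : BR_test D H J x0.
  split; last by apply/eqP; rewrite monalgU_eq0.
  by left; exists a, (lcoef x a); split=> //; rewrite lconst_tmon.
rewrite -(test_full tx) => _ [s sB ->]; apply: additive_set_sum => // -[u v] /sB[/= Bu].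
move: v; apply: BR_algebra_sub => [|d s' Is].
  exact: additive_mulr.
move: u Bu; apply: BR_algebra_sub => [|c r Ir].
  exact: additive_mull (additive_mull _ aP).
have Br := BR_algebra_mon Ir; have Bs := BR_algebra_mon Is.
have [e|ne] := eqVneq d (- (c + a)).
  exists (lmon D r c * x * lmon D s' d); split=> [||b].
  - by case: (IM _ _ Bs (proj1 (IM _ _ Br Ix))).
  - have -> : 0 = c + a + d by rewrite e subrr.
    by rewrite [LHS]lcoef_sandwich [RHS]lcoef_sandwich x0a.
  - have {1}-> : b = c + (b + a) + d by rewrite e opprD addrA [c + _]addrC !addrK.
    rewrite lcoef_sandwich; apply: contraNneq => xb.
    by rewrite xb raddf0 mulr0 scaler0 mul0r scaler0.
exists 0; split=> // [|b]; last by rewrite lcoef0 eqxx.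
have -> : 0 = c + (- c - d) + d :> multideg n by rewrite addrA subrr add0r addNr.
rewrite lcoef0 lcoef_sandwich lcoef_mon.
case: eqP => [e|_]; last by rewrite raddf0 mulr0 scaler0 mul0r scaler0.
by case/eqP: ne; rewrite -e addNKr opprK.
Qed.

(** Induction on the size of the support: unless the normalised element is
    central, its commutator with a homogeneous element loses the constant
    term. *)
Lemma ideal_full_of_supported k I s x : ideal_of B I -> (0 < n)%N ->
  (size s <= k)%N -> supported s x -> I x -> x != 0 -> I 1.
Proof.
move=> iI n0; have [subI I0 ID IM] := iI.
elim: k s x => [|k IHk] s x sk sx Ix /lcoef_neq0[a xa].
  by move: sk (sx a xa); rewrite leqn0 size_eq0 => /eqP->.
(* Multiplication by r t^(e - a) moves the degree a to e > 0. *)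
pose e : multideg n := [ffun=> 1].
have [r Ir r0] := BR_ideal_nonzero BR R_domain (e - a).
have epos : pos_deg e.
  split=> [i|]; first by rewrite ffunE.
  by apply/eqP => /ffunP/(_ (Ordinal n0)); rewrite !ffunE.
have Ixr : I (x * lmon D r (e - a)) by case: (IM _ _ (BR_algebra_mon Ir) Ix).
have xre : lcoef (x * lmon D r (e - a)) e != 0.
  by rewrite -{2}(subrKC a e); exact: lcoef_monMr_neq0.
have [y [Iy y1 yx]] := normalize iI Ixr epos xre.
pose t := [seq b - a | b <- s].
have yt : supported t y.
  move=> b /yx; have -> : b + e = b + a + (e - a) by rewrite -addrA subrKC.
  rewrite lcoef_monMr => xb; apply/mapP; exists (b + a); last by rewrite addrK.
  apply: sx; apply: contraNneq xb => ->; by rewrite mul0r scaler0.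
have By := subI _ Iy.
have [Cy|nC] := pselect (center B y).
  have [c _ yE] := center_base Cy; move: y1 Iy; rewrite -yE lcoef_const eqxx => ->.
  by [].
have [d [s' [Is Ih0]]] : exists d s', IB d s' /\ lmon D s' d * y - y * lmon D s' d != 0.
  apply: contrapT => no; apply: nC; split=> // h; move: h.
  apply: BR_algebra_sub => [|d s' Is]; first exact: additive_centralizer.
  apply/esym/eqP; rewrite -subr_eq0; apply: contrapT => /negP ne.
  by apply: no; exists d, s'.
have Bs := BR_algebra_mon Is.
have [Isy Iys] := IM _ _ Bs Iy.
have t0 : 0 \in t by apply: yt; rewrite y1 oner_eq0.
(* The constant terms of h y and y h, both equal to h, cancel in degree d. *)
apply: (IHk [seq b + d | b <- rem 0 t] _ _ _ (ID _ _ Isy Iys) Ih0).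
  by rewrite size_map size_rem // size_map; case: (size s) sk.
move=> b; rewrite -[b](subrK d) => ne; apply: map_f; move: ne.
rewrite lcoefB lcoef_monMr [b - d + d]addrC lcoef_monMl.
have [->|b0] := eqVneq (b - d) 0.
  by rewrite y1 cocycle0l cocycle0r !scale1r sigma_deg0 sigma_deg1 mulr1 mul1r subrr eqxx.
move=> ne; suff /yt : lcoef y (b - d) != 0.
  by rewrite (perm_mem (perm_to_rem t0)) inE (negbTE b0).
by apply: contraNneq ne => ->; rewrite raddf0 mulr0 mul0r !scaler0 subrr.
Qed.

Lemma BR_group_rank0 g : n = 0%N -> BR_group D g -> g = id.
Proof.
move=> n0; elim=> {g} [g [i _]|//|g h _ -> _ -> //|g h gK _ _ gE].
  by case: i => j; rewrite n0.
by apply/funext => r; rewrite -{1}[r]/(id r) -gE gK.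
Qed.

Lemma ideal_full_rank0 I x : n = 0%N -> ideal_of B I -> I x -> x != 0 -> I 1.
Proof.
move=> n0 iI Ix /lcoef_neq0[a xa]; have [subI I0 ID IM] := iI.
have deg0 (b : multideg n) : b = 0.
  apply/ffunP => i; suff: False by [].
  by case: i => j; rewrite n0.
pose I' := [set r | I (lconst D r)].
have iI' : ideal_of setT I'.
  split=> // [|r s Ir Is|r s _ Is]; rewrite /I' /mkset ?raddf0 ?raddfB; [done|exact: ID|].
  by rewrite !rmorphM; exact: IM _ _ (BR_algebra_const _) Is.
have xE : x = lconst D (lcoef x a).
  by apply/lcoefP => b; rewrite lcoef_const (deg0 b) (deg0 a) eqxx.
have fixI g : BR_group D g -> g @` I' = I'.
  by move=> /(BR_group_rank0 n0) ->; exact: image_id.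
case: (gammaR iI' fixI) => IE; last by have : I' 1 by rewrite IE.
by move: Ix xa; rewrite xE -[I _]/(I' _) IE => ->; rewrite raddf0 lcoef0 eqxx.
Qed.

Lemma conditions_simple : simple_ring B.
Proof.
split=> [B0|I iI].
  by have := BR_algebra1; rewrite B0 => /eqP; rewrite oner_eq0.
have [[x Ix x0]|no] := pselect (exists2 x, I x & x != 0).
  right; apply: ideal_eq_full => //; case: (posnP n) => n0.
    exact: ideal_full_rank0 n0 iI Ix x0.
  exact: (ideal_full_of_supported iI n0 (leqnn (size (msupp x))) (@supported_msupp _ _ _ D x)).
left; apply/seteqP; split=> [x Ix|_ ->]; last by case: iI.
by apply: contrapT => /eqP x0; apply: no; exists x.
Qed.

End ConditionsImply.
End Algebra.

Theorem theorem5p10 (K : fieldType) (R : comAlgType K) (n : nat)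
    (D : laurentData R n) (H J : 'I_n -> set R)
    (R_domain : forall x y : R, x * y = 0 -> x = 0 \/ y = 0)
    (R_noetherian : noetherian R)
    (BR : BR_conditions D H J) :
  simple_ring (BR_algebra D H J) <->
  [/\ (forall x, BR_test D H J x ->
         principal (BR_algebra D H J) x = BR_algebra D H J),
      gamma_simple (BR_group D) &
      center (BR_algebra D H J) `<=` BR_base D].
Proof.
split=> [sB|[h1 h2 h3]]; last exact: (conditions_simple BR).
split; [exact: simple_principal|exact: (simple_gamma_simple BR)|].
exact: (simple_center BR).
Qed.
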